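(* Let $0\to V\to\widehat{\mathfrak p}\xrightarrow{p}\mathfrak p\to0$ be an abelian extension of crossed modules over Leibniz algebras, with $V=(V_1,V_0,\varphi)$, $\mathfrak p=(\mathfrak p_1,\mathfrak p_0,f)$, $\widehat{\mathfrak p}=(\widehat{\mathfrak p}_1,\widehat{\mathfrak p}_0,\widehat f)$, and a fixed section $\sigma=(\sigma_0,\sigma_1)$; let $(\beta,\alpha)\in\mathrm{Aut}(V)\times\mathrm{Aut}(\mathfrak p)$. Then $(\beta,\alpha)$ is inducible if and only if there exist linear maps $\lambda_0:\mathfrak p_0\to V_0$ and $\lambda_1:\mathfrak p_1\to V_1$ such that for all $x,y\in\mathfrak p_0$, $a\in\mathfrak p_1$, $v\in V_0$, $m\in V_1$: \begin{align*} &\beta_0(\theta(a))-\theta(\alpha_1(a))=\varphi(\lambda_1(a))-\lambda_0(f(a)),\\ &\beta_0(\omega(x,y))-\omega(\alpha_0(x),\alpha_0(y))=l_0(\alpha_0(x))(\lambda_0(y))+r_0(\alpha_0(y))(\lambda_0(x))-\lambda_0([x,y]),\\ &\beta_1(\mu(x,a))-\mu(\alpha_0(x),\alpha_1(a))=l_0(\alpha_0(x))(\lambda_1(a))+r_1(\alpha_1(a))(\lambda_0(x))-\lambda_1([x,a]),\\ &\beta_1(\nu(a,x))-\nu(\alpha_1(a),\alpha_0(x))=r_0(\alpha_0(x))(\lambda_1(a))+l_1(\alpha_1(a))(\lambda_0(x))-\lambda_1([a,x]),\\ &\beta_0l_0(x)\beta_0^{-1}(v)=l_0(\alpha_0(x))(v),\qquad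 \beta_0r_0(x)\beta_0^{-1}(v)=r_0(\alpha_0(x))(v),\\ &\beta_1l_0(x)\beta_1^{-1}(m)=l_0(\alpha_0(x))(m),\qquad \beta_1r_0(x)\beta_1^{-1}(m)=r_0(\alpha_0(x))(m),\\ &\beta_1r_1(a)\beta_0^{-1}(v)=r_1(\alpha_1(a))(v),\qquad \beta_1l_1(a)\beta_0^{-1}(v)=l_1(\alpha_1(a))(v). \end{align*}
   Context: All vector spaces are over a fixed field. A Leibniz algebra is a vector space with a bilinear bracket satisfying $[x,[y,z]]=[[x,y],z]+[y,[x,z]]$. A representation of a Leibniz algebra $\mathfrak p_0$ is a vector space $M$ with bilinear maps $\mathfrak p_0\otimes M\to M$, $M\otimes\mathfrak p_0\to M$ (both written $\cdot$) with $[x,y]\cdot m=x\cdot(y\cdot m)-y\cdot(x\cdot m)$; $m\cdot[x,y]=(m\cdot x)\cdot y+x\cdot(m\cdot y)$; $m\cdot[x,y]=x\cdot(m\cdot y)-(x\cdot m)\cdot y$. A crossed module over Leibniz algebra is a triple $(\mathfrak p_1,\mathfrak p_0,f)$ with $\mathfrak p_0$ a Leibniz algebra, $\mathfrak p_1$ a representation of $\mathfrak p_0$, and $f:\mathfrak p_1\to\mathfrak p_0$ linear with $f(x\cdot a)=[x,f(a)]$, $f(a\cdot x)=[f(a),x]$ and $f(a)\cdot b=a\cdot f(b)$. (No bracket on $\mathfrak p_1$ is required.) Write $[x,a]=x\cdot a$, $[a,x]=a\cdot x$. A homomorphism $F=(F_0,F_1)$ consists of linear maps $F_i:\mathfrak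 p_i\to\mathfrak p_i'$ with $F_0f=f'F_1$, $F_0[x,y]=[F_0x,F_0y]'$, $F_1[x,a]=[F_0x,F_1a]'$, $F_1[a,x]=[F_1a,F_0x]'$; it is an automorphism if it is an endomorphism with $F_0,F_1$ bijective. An extension of $(\mathfrak p_1,\mathfrak p_0,f)$ by $(V_1,V_0,\varphi)$ is a sequence $0\to V\to\widehat{\mathfrak p}\xrightarrow{p}\mathfrak p\to0$ of crossed modules and homomorphisms which is short exact in each degree ($V\to\widehat{\mathfrak p}$ regarded as an inclusion). It is abelian if the bracket on $V_0$ is zero and the actions of $V_0$ on $V_1$ are zero. A section $\sigma=(\sigma_0,\sigma_1)$ is a pair of linear maps $\sigma_i:\mathfrak p_i\to\widehat{\mathfrak p}_i$ with $p_i\sigma_i=\mathrm{id}$. For $x,y\in\mathfrak p_0$, $a\in\mathfrak p_1$, $w\in V_0$, $m\in V_1$: $l_0(x)(w+m)=[\sigma_0x,w+m]$, $r_0(x)(w+m)=[w+m,\sigma_0x]$, $l_1(a)(w)=[\sigma_1a,w]$, $r_1(a)(w)=[w,\sigma_1a]$; and $\theta(a)=\widehat f\sigma_1(a)-\sigma_0(f(a))\in V_0$, $\omega(x,y)=[\sigma_0x,\sigma_0y]-\sigma_0[x,y]\in V_0$, $\mu(x,a)=[\sigma_0x,\sigma_1a]-\sigma_1[x,a]\in V_1$, $\nu(a,x)=[\sigma_1a,\sigma_0x]-\sigma_1[a,x]\in V_1$. $\mathrm{Aut}(V)$, $\mathrm{Aut}(\mathfrak p)$ are the groups of crossed module automorphisms.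 $\mathrm{Aut}_V(\widehat{\mathfrak p})$ is the group of automorphisms $F=(F_0,F_1)$ of $\widehat{\mathfrak p}$ with $F_0(V_0)=V_0$, $F_1(V_1)=V_1$; put $F|_V=(F_0|_{V_0},F_1|_{V_1})$, $\overline F=(p_0F_0\sigma_0,p_1F_1\sigma_1)$. A pair $(\beta,\alpha)$, $\beta=(\beta_0,\beta_1)$, $\alpha=(\alpha_0,\alpha_1)$, is inducible if there is $F\in\mathrm{Aut}_V(\widehat{\mathfrak p})$ with $F|_V=\beta$ and $\overline F=\alpha$. *)

(* Defs.v *)
From HB Require Import structures.
From mathcomp Require Import all_boot all_order all_algebra.
Set Implicit Arguments.
Unset Strict Implicit.
Unset Printing Implicit Defensive.

Import GRing.Theory.
Local Open Scope ring_scope.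

(* [lmodType K] imposes no finiteness on the dimension. *)
Record leibnizAlgebra (K : fieldType) := LeibnizAlgebra {
  leib_sort :> lmodType K;
  leib_br : {bilinear leib_sort -> leib_sort -> leib_sort};
  leib_identity : forall x y z : leib_sort,
    leib_br x (leib_br y z) = leib_br (leib_br x y) z + leib_br y (leib_br x z)
}.

Record representation (K : fieldType) (L : leibnizAlgebra K) :=
  Representation {
  rep_sort :> lmodType K;
  rep_lact : {bilinear L -> rep_sort -> rep_sort};
  rep_ract : {bilinear rep_sort -> L -> rep_sort};
  rep_llm : forall (x y : L) (m : rep_sort),
    rep_lact (leib_br L x y) m
    = rep_lact x (rep_lact y m) - rep_lact y (rep_lact x m);
  rep_mll : forall (x y : L) (m : rep_sort),
    rep_ract m (leib_br L x y)
    = rep_ract (rep_ract m x) y + rep_lact x (rep_ract m y);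
  rep_lml : forall (x y : L) (m : rep_sort),
    rep_ract m (leib_br L x y)
    = rep_lact x (rep_ract m y) - rep_ract (rep_lact x m) y
}.

Record crossedModule (K : fieldType) := CrossedModule {
  cm0 : leibnizAlgebra K;
  cm1 : representation cm0;
  cmf : {linear cm1 -> cm0};
  cmf_lact : forall (x : cm0) (a : cm1),
    cmf (rep_lact cm1 x a) = leib_br cm0 x (cmf a);
  cmf_ract : forall (a : cm1) (x : cm0),
    cmf (rep_ract cm1 a x) = leib_br cm0 (cmf a) x;
  cmf_peiffer : forall a b : cm1,
    rep_lact cm1 (cmf a) b = rep_ract cm1 a (cmf b)
}.

Definition br (K : fieldType) (p : crossedModule K) (x y : cm0 p) : cm0 p :=
  leib_br (cm0 p) x y.
Definition brl (K : fieldType) (p : crossedModule K)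
  (x : cm0 p) (a : cm1 p) : cm1 p := rep_lact (cm1 p) x a.
Definition brr (K : fieldType) (p : crossedModule K)
  (a : cm1 p) (x : cm0 p) : cm1 p := rep_ract (cm1 p) a x.

Record cmHom (K : fieldType) (p q : crossedModule K) := CMHom {
  hom0 : {linear cm0 p -> cm0 q};
  hom1 : {linear cm1 p -> cm1 q};
  hom_f : forall a : cm1 p, hom0 (cmf p a) = cmf q (hom1 a);
  hom_br : forall x y : cm0 p, hom0 (br x y) = br (hom0 x) (hom0 y);
  hom_brl : forall (x : cm0 p) (a : cm1 p),
    hom1 (brl x a) = brl (hom0 x) (hom1 a);
  hom_brr : forall (a : cm1 p) (x : cm0 p),
    hom1 (brr a x) = brr (hom1 a) (hom0 x)
}.

Record cmAut (K : fieldType) (p : crossedModule K) := CMAut {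
  aut_hom :> cmHom p p;
  aut_bij0 : bijective (hom0 aut_hom);
  aut_bij1 : bijective (hom1 aut_hom)
}.

Section Antecedent.
Variables (A : choiceType) (B : eqType) (f : A -> B).

Lemma antecedent_subproof (b : B) : (exists a, b = f a) -> exists a, f a == b.
Proof. by case=> a ->; exists a. Qed.

Definition antecedent (b : B) (h : exists a, b = f a) : A :=
  xchoose (antecedent_subproof h).

Lemma antecedentK (b : B) (h : exists a, b = f a) : f (antecedent h) = b.
Proof. exact/eqP/(xchooseP (antecedent_subproof h)). Qed.

Lemma bij_antecedent : bijective f -> forall b, exists a, b = f a.
Proof. by case=> g _ gK b; exists (g b). Qed.

End Antecedent.

Section AutInverse.
Variables (K : fieldType) (p : crossedModule K) (F : cmAut p).

Definition aut_inv0 (x : cm0 p) : cm0 p :=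
  antecedent (bij_antecedent (aut_bij0 F) x).
Definition aut_inv1 (a : cm1 p) : cm1 p :=
  antecedent (bij_antecedent (aut_bij1 F) a).

Lemma aut_inv0K : cancel aut_inv0 (hom0 F).
Proof. by move=> x; exact: antecedentK. Qed.
Lemma aut_inv1K : cancel aut_inv1 (hom1 F).
Proof. by move=> x; exact: antecedentK. Qed.
Lemma aut_0K : cancel (hom0 F) aut_inv0.
Proof. by move=> x; apply: (bij_inj (aut_bij0 F)); rewrite aut_inv0K. Qed.
Lemma aut_1K : cancel (hom1 F) aut_inv1.
Proof. by move=> x; apply: (bij_inj (aut_bij1 F)); rewrite aut_inv1K. Qed.

End AutInverse.

(* [V] is not literally a subspace of [ph]: the inclusion is the injective    *)
(* homomorphism [ext_i], and elements of [V_0], [V_1] given by formulas in    *)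
(* [ph] are pulled back along it by [to_V0], [to_V1] below.                   *)
Record extension (K : fieldType) (V ph p : crossedModule K) := Extension {
  ext_i : cmHom V ph;
  ext_p : cmHom ph p;
  ext_inj0 : injective (hom0 ext_i);
  ext_inj1 : injective (hom1 ext_i);
  ext_exact0 : forall z : cm0 ph,
    hom0 ext_p z = 0 <-> exists v : cm0 V, z = hom0 ext_i v;
  ext_exact1 : forall z : cm1 ph,
    hom1 ext_p z = 0 <-> exists m : cm1 V, z = hom1 ext_i m;
  ext_surj0 : forall x : cm0 p, exists z : cm0 ph, hom0 ext_p z = x;
  ext_surj1 : forall a : cm1 p, exists z : cm1 ph, hom1 ext_p z = a
}.

(* This depends on the kernel [V] only. *)
Definition abelian_extension (K : fieldType) (V ph p : crossedModule K)
    (E : extension V ph p) : Prop :=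
  [/\ forall v w : cm0 V, br v w = 0,
      forall (v : cm0 V) (m : cm1 V), brl v m = 0
    & forall (m : cm1 V) (v : cm0 V), brr m v = 0].

Record extSection (K : fieldType) (V ph p : crossedModule K)
    (E : extension V ph p) := ExtSection {
  sec0 : {linear cm0 p -> cm0 ph};
  sec1 : {linear cm1 p -> cm1 ph};
  sec0K : cancel sec0 (hom0 (ext_p E));
  sec1K : cancel sec1 (hom1 (ext_p E))
}.

Section ExtensionData.
Variables (K : fieldType) (V ph p : crossedModule K).
Variables (E : extension V ph p) (s : extSection E).

Local Notation i0 := (hom0 (ext_i E)).
Local Notation i1 := (hom1 (ext_i E)).
Local Notation p0 := (hom0 (ext_p E)).
Local Notation p1 := (hom1 (ext_p E)).
Local Notation s0 := (sec0 s).
Local Notation s1 := (sec1 s).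

Definition to_V0 (z : cm0 ph) (hz : p0 z = 0) : cm0 V :=
  antecedent ((ext_exact0 E z).1 hz).
Definition to_V1 (z : cm1 ph) (hz : p1 z = 0) : cm1 V :=
  antecedent ((ext_exact1 E z).1 hz).

Lemma to_V0K z (hz : p0 z = 0) : i0 (to_V0 hz) = z.
Proof. exact: antecedentK. Qed.
Lemma to_V1K z (hz : p1 z = 0) : i1 (to_V1 hz) = z.
Proof. exact: antecedentK. Qed.

Lemma p0i0 v : p0 (i0 v) = 0.
Proof. by apply/(ext_exact0 E); exists v. Qed.
Lemma p1i1 m : p1 (i1 m) = 0.
Proof. by apply/(ext_exact1 E); exists m. Qed.

Lemma l00_ker x w : p0 (br (s0 x) (i0 w)) = 0.
Proof. by rewrite hom_br p0i0 /br linear0r. Qed.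
Lemma l01_ker x m : p1 (brl (s0 x) (i1 m)) = 0.
Proof. by rewrite hom_brl p1i1 /brl linear0r. Qed.
Lemma r00_ker x w : p0 (br (i0 w) (s0 x)) = 0.
Proof. by rewrite hom_br p0i0 /br linear0l. Qed.
Lemma r01_ker x m : p1 (brr (i1 m) (s0 x)) = 0.
Proof. by rewrite hom_brr p1i1 /brr linear0l. Qed.
Lemma l1_ker a w : p1 (brr (s1 a) (i0 w)) = 0.
Proof. by rewrite hom_brr p0i0 /brr linear0r. Qed.
Lemma r1_ker a w : p1 (brl (i0 w) (s1 a)) = 0.
Proof. by rewrite hom_brl p0i0 /brl linear0l. Qed.

(* [l0j], [r0j] are the restrictions of [l_0], [r_0] to [V_j]. *)
Definition l00 (x : cm0 p) (w : cm0 V) : cm0 V := to_V0 (l00_ker x w).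
Definition l01 (x : cm0 p) (m : cm1 V) : cm1 V := to_V1 (l01_ker x m).
Definition r00 (x : cm0 p) (w : cm0 V) : cm0 V := to_V0 (r00_ker x w).
Definition r01 (x : cm0 p) (m : cm1 V) : cm1 V := to_V1 (r01_ker x m).
Definition l1 (a : cm1 p) (w : cm0 V) : cm1 V := to_V1 (l1_ker a w).
Definition r1 (a : cm1 p) (w : cm0 V) : cm1 V := to_V1 (r1_ker a w).

Lemma theta_ker a : p0 (cmf ph (s1 a) - s0 (cmf p a)) = 0.
Proof. by rewrite linearB /= hom_f sec0K sec1K subrr. Qed.
Lemma omega_ker x y : p0 (br (s0 x) (s0 y) - s0 (br x y)) = 0.
Proof. by rewrite linearB /= hom_br !sec0K subrr. Qed.
Lemma mu_ker x a : p1 (brl (s0 x) (s1 a) - s1 (brl x a)) = 0.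
Proof. by rewrite linearB /= hom_brl sec0K !sec1K subrr. Qed.
Lemma nu_ker a x : p1 (brr (s1 a) (s0 x) - s1 (brr a x)) = 0.
Proof. by rewrite linearB /= hom_brr sec0K !sec1K subrr. Qed.

Definition theta (a : cm1 p) : cm0 V := to_V0 (theta_ker a).
Definition omega (x y : cm0 p) : cm0 V := to_V0 (omega_ker x y).
Definition mu (x : cm0 p) (a : cm1 p) : cm1 V := to_V1 (mu_ker x a).
Definition nu (a : cm1 p) (x : cm0 p) : cm1 V := to_V1 (nu_ker a x).

(* The last two fields say [F_j(V_j) = V_j] as an equality of subsets. *)
Record autV := AutV {
  autV_aut :> cmAut ph;
  autV_stab0 : forall z : cm0 ph,
    (exists v : cm0 V, z = hom0 autV_aut (i0 v)) <->
    (exists v : cm0 V, z = i0 v);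
  autV_stab1 : forall z : cm1 ph,
    (exists m : cm1 V, z = hom1 autV_aut (i1 m)) <->
    (exists m : cm1 V, z = i1 m)
}.

Lemma autV_sub0 (F : autV) v : exists w, hom0 F (i0 v) = i0 w.
Proof. by apply/(autV_stab0 F); exists v. Qed.
Lemma autV_sub1 (F : autV) m : exists n, hom1 F (i1 m) = i1 n.
Proof. by apply/(autV_stab1 F); exists m. Qed.

Definition restr0 (F : autV) (v : cm0 V) : cm0 V := antecedent (autV_sub0 F v).
Definition restr1 (F : autV) (m : cm1 V) : cm1 V := antecedent (autV_sub1 F m).

Lemma restr0K F v : i0 (restr0 F v) = hom0 F (i0 v).
Proof. exact: antecedentK. Qed.
Lemma restr1K F m : i1 (restr1 F m) = hom1 F (i1 m).
Proof. exact: antecedentK. Qed.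

Definition induced0 (F : autV) (x : cm0 p) : cm0 p := p0 (hom0 F (s0 x)).
Definition induced1 (F : autV) (a : cm1 p) : cm1 p := p1 (hom1 F (s1 a)).

Definition inducible (beta : cmAut V) (alpha : cmAut p) : Prop :=
  exists F : autV,
    [/\ restr0 F =1 hom0 beta, restr1 F =1 hom1 beta,
        induced0 F =1 hom0 alpha & induced1 F =1 hom1 alpha].

End ExtensionData.

(* Main.v *)
(* In each degree the section splits the extension linearly, so an            *)
(* automorphism F with F|_V = beta and induced map alpha is determined by     *)
(* lambda := F s - s alpha, which takes values in V, and conversely           *)
(* F (v + s x) := beta v + lambda x + s (alpha x) is always a linear          *)
(* automorphism.  Evaluating compatibility of F with a bracket on pairs from  *)
(* s p and V turns it into one cocycle equation (both entries in s p) and two *)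
(* equivariance equations (one entry in V); the case of two entries in V is   *)
(* empty since V is abelian.  The three brackets are instances of a single    *)
(* statement on bilinear maps between split extensions.                       *)
Require Import Defs.
From HB Require Import structures.
From mathcomp Require Import all_boot all_order all_algebra.
Import GRing.Theory.
Local Open Scope ring_scope.
Set Implicit Arguments.
Unset Strict Implicit.

(** With respect to the splitting into [V] and the image of the section, F is block triangular:
    diagonal blocks beta and alpha, corner lambda ([adapted]). The defect of F against the structure
    map or a bracket is additive in each argument, so it vanishes iff it vanishes on elements of [V]
    and of the section. The section components cancel because alpha is a homomorphism; the [V]
    components are the stated equations ([commute_linearP], [preserve_bilinearP]). Conversely any
    lambda gives a triangular map [glue], invertible since beta and alpha are. *)

Lemma subr_eq_subr (V : zmodType) (a b c d : V) :
  a - b = c - d <-> d + a = b + c.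
Proof.
split=> [e | e].
  by rewrite -[a](subrK b) e addrA addrCA subrr addr0 addrC.
by apply: (addrI d); rewrite addrA e addrAC subrr add0r addrC subrK.
Qed.

(** * Split short exact sequences and triangular maps *)

Record splitExact (K : fieldType) (V H P : lmodType K) := SplitExact {
  spl_i : {linear V -> H};
  spl_p : {linear H -> P};
  spl_s : {linear P -> H};
  spl_inj : injective spl_i;
  spl_exact : forall z, spl_p z = 0 <-> exists v, z = spl_i v;
  spl_sK : cancel spl_s spl_p
}.

Arguments spl_inj {K V H P} _ [x1 x2] _.
Arguments spl_sK {K V H P} _ x.

Section Splitting.
Variables (K : fieldType) (V H P : lmodType K) (S : splitExact V H P).
Local Notation i := (spl_i S).
Local Notation q := (spl_p S).
Local Notation s := (spl_s S).

Lemma spl_pi v : q (i v) = 0.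
Proof. by apply/(spl_exact S); exists v. Qed.

Lemma retract_ker z : exists v, z - s (q z) = i v.
Proof. by apply/(spl_exact S); rewrite linearB /= spl_sK subrr. Qed.

(** The projection onto V along the image of s. *)
Definition retract (z : H) : V := antecedent (retract_ker z).

Lemma retractE z : i (retract z) = z - s (q z).
Proof. exact: antecedentK. Qed.

Lemma retract_linear : linear retract.
Proof.
move=> k z w; apply: (spl_inj S).
by rewrite linearP /= !retractE !linearP /= scalerDr addrACA.
Qed.

HB.instance Definition _ := GRing.isLinear.Build K H V *:%R retract retract_linear.

Lemma retract_i : cancel i retract.
Proof. by move=> v; apply: (spl_inj S); rewrite retractE spl_pi linear0 subr0. Qed.

Lemma retract_s x : retract (s x) = 0.
Proof. by apply: (spl_inj S); rewrite retractE spl_sK subrr linear0. Qed.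

Lemma split_decomp z : z = i (retract z) + s (q z).
Proof. by rewrite retractE subrK. Qed.

Definition adapted (F : H -> H) (b : V -> V) (a : P -> P) (lam : P -> V) :=
  (forall v, F (i v) = i (b v)) /\ (forall x, F (s x) = s (a x) + i (lam x)).

Lemma adapted_retract (F : H -> H) b a :
    (forall v, F (i v) = i (b v)) -> (forall x, q (F (s x)) = a x) ->
  adapted F b a (fun x => retract (F (s x))).
Proof. by move=> Fi Fs; split=> // x; rewrite retractE Fs addrC subrK. Qed.

(** Point-free, so that linearity is inferred from that of the factors. *)
Definition glue (b : V -> V) (a : P -> P) (lam : P -> V) : H -> H :=
  (i \o ((b \o retract) \+ (lam \o q))) \+ (s \o (a \o q)).

Section Glue.
Variables (b : {linear V -> V}) (a : {linear P -> P}) (lam : {linear P -> V}).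
Local Notation F := (glue b a lam).

Lemma glue_linear : linear F.
Proof. exact: linearP. Qed.

HB.instance Definition _ := GRing.isLinear.Build K H H *:%R F glue_linear.

Lemma glue_adapted : adapted F b a lam.
Proof.
split=> [v|x]; rewrite /glue /=.
  by rewrite retract_i spl_pi !linear0 !addr0.
by rewrite retract_s spl_sK linear0 add0r addrC.
Qed.

Lemma p_glue z : q (F z) = a (q z).
Proof. by rewrite /glue /= linearD /= spl_pi spl_sK add0r. Qed.

Lemma glue_bij : bijective b -> bijective a -> bijective F.
Proof.
move=> [b' bK b'K] [a' aK a'K].
(* Back substitution: invert [a] on the quotient first, then remove the contribution of [lam] and
   invert [b]. *)
exists (fun z => i (b' (retract z - lam (a' (q z)))) + s (a' (q z))) => z.
  rewrite p_glue aK [in RHS](split_decomp z); congr (i _ + _).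
  by rewrite /glue /= linearD /= retract_i retract_s addr0 addrK bK.
set z' := (X in F X); have qz' : q z' = a' (q z).
  by rewrite linearD /= spl_pi spl_sK add0r.
have rz' : retract z' = b' (retract z - lam (a' (q z))).
  by rewrite linearD /= retract_i retract_s addr0.
by rewrite /glue /= qz' rz' b'K a'K subrK -split_decomp.
Qed.

Lemma glue_stab : bijective b ->
  forall z, (exists v, z = F (i v)) <-> (exists v, z = i v).
Proof.
move=> [b' bK b'K] z; split=> -[v ->].
  by exists (b v); rewrite (proj1 glue_adapted).
by exists (b' v); rewrite (proj1 glue_adapted) b'K.
Qed.

End Glue.
End Splitting.

(** * Compatibility with structure maps and brackets *)

Section SplitLinear.
Variables (K : fieldType) (V1 H1 P1 V2 H2 P2 : lmodType K).
Variables (S1 : splitExact V1 H1 P1) (S2 : splitExact V2 H2 P2).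
Variables (F1 : {linear H1 -> H1}) (b1 : V1 -> V1) (a1 : P1 -> P1) (lam1 : P1 -> V1).
Variables (F2 : {linear H2 -> H2}) (b2 : {linear V2 -> V2}).
Variables (a2 : {linear P2 -> P2}) (lam2 : P2 -> V2).
Variables (h : {linear H1 -> H2}) (hV : V1 -> V2) (hP : P1 -> P2).
Variables (th : P1 -> V2).
Hypotheses (F1a : adapted S1 F1 b1 a1 lam1) (F2a : adapted S2 F2 b2 a2 lam2).
Hypotheses (h_i : forall v, h (spl_i S1 v) = spl_i S2 (hV v)).
Hypotheses (thE : forall x, spl_i S2 (th x) = h (spl_s S1 x) - spl_s S2 (hP x)).
Hypotheses (b_h : forall v, b2 (hV v) = hV (b1 v)).
Hypotheses (a_h : forall x, a2 (hP x) = hP (a1 x)).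

(** On V1 the square commutes by [b_h]; only its restriction to the section carries a condition. *)
Lemma commute_linearP :
  (forall z, F2 (h z) = h (F1 z)) <->
  (forall x, b2 (th x) - th (a1 x) = hV (lam1 x) - lam2 (hP x)).
Proof.
have [F1i F1s] := F1a; have [F2i F2s] := F2a.
have hs x : h (spl_s S1 x) = spl_s S2 (hP x) + spl_i S2 (th x).
  by rewrite thE addrC subrK.
have on_s x : F2 (h (spl_s S1 x)) = h (F1 (spl_s S1 x)) <->
    b2 (th x) - th (a1 x) = hV (lam1 x) - lam2 (hP x).
  apply: (iff_trans _ (iff_sym (subr_eq_subr _ _ _ _))); rewrite F1s hs !linearD /= F2s F2i h_i hs a_h -!addrA -!linearD.
  by split=> [/addrI/(spl_inj S2)|->].
split=> [comm x | eqs z]; first exact/on_s.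
rewrite (split_decomp S1 z) !linearD /= F1i !h_i F2i b_h; congr (_ + _).
exact/on_s.
Qed.

End SplitLinear.

Section SplitBilinear.
Variables (K : fieldType) (V1 H1 P1 V2 H2 P2 V3 H3 P3 : lmodType K).
Variables (S1 : splitExact V1 H1 P1) (S2 : splitExact V2 H2 P2).
Variable S3 : splitExact V3 H3 P3.
Variables (F1 : {linear H1 -> H1}) (b1 : V1 -> V1) (a1 : P1 -> P1) (lam1 : P1 -> V1).
Variables (F2 : {linear H2 -> H2}) (b2 : V2 -> V2) (a2 : P2 -> P2) (lam2 : P2 -> V2).
Variables (F3 : {linear H3 -> H3}) (b3 : V3 -> V3) (a3 : P3 -> P3) (lam3 : P3 -> V3).
Variables (B : {bilinear H1 -> H2 -> H3}) (BP : P1 -> P2 -> P3).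
Variables (om : P1 -> P2 -> V3) (l : P1 -> V2 -> V3) (r : P2 -> V1 -> V3).
Hypotheses (F1a : adapted S1 F1 b1 a1 lam1) (F2a : adapted S2 F2 b2 a2 lam2).
Hypothesis F3a : adapted S3 F3 b3 a3 lam3.
Hypothesis omE : forall x y,
  spl_i S3 (om x y) = B (spl_s S1 x) (spl_s S2 y) - spl_s S3 (BP x y).
Hypothesis lE : forall x w, spl_i S3 (l x w) = B (spl_s S1 x) (spl_i S2 w).
Hypothesis rE : forall y v, spl_i S3 (r y v) = B (spl_i S1 v) (spl_s S2 y).
Hypothesis B_i : forall v w, B (spl_i S1 v) (spl_i S2 w) = 0.
Hypothesis a_B : forall x y, a3 (BP x y) = BP (a1 x) (a2 y).

(** Pairs of section elements give the cocycle equation, mixed pairs the two equivariance equations;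
    on V1 x V2 both sides vanish by [B_i]. *)
Lemma preserve_bilinearP :
  (forall z w, F3 (B z w) = B (F1 z) (F2 w)) <->
  [/\ forall x y, b3 (om x y) - om (a1 x) (a2 y) =
         l (a1 x) (lam2 y) + r (a2 y) (lam1 x) - lam3 (BP x y),
      forall x w, b3 (l x w) = l (a1 x) (b2 w)
    & forall y v, b3 (r y v) = r (a2 y) (b1 v)].
Proof.
have [F1i F1s] := F1a; have [F2i F2s] := F2a; have [F3i F3s] := F3a.
have Bs x y : B (spl_s S1 x) (spl_s S2 y) = spl_s S3 (BP x y) + spl_i S3 (om x y).
  by rewrite omE addrC subrK.
have on_ss x y : F3 (B (spl_s S1 x) (spl_s S2 y)) =
      B (F1 (spl_s S1 x)) (F2 (spl_s S2 y)) <->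
    b3 (om x y) - om (a1 x) (a2 y) =
      l (a1 x) (lam2 y) + r (a2 y) (lam1 x) - lam3 (BP x y).
  apply: (iff_trans _ (iff_sym (subr_eq_subr _ _ _ _))); rewrite F1s F2s Bs linearD /= F3s F3i a_B.
  (* The quadratic term in [lam1 x] and [lam2 y] dies by [B_i], leaving the linear terms [l] and
     [r]. *)
  rewrite linearDl !linearDr /= Bs B_i addr0 -lE -rE -!addrA -!linearD.
  by split=> [/addrI/(spl_inj S3)|->].
have on_si x w : F3 (B (spl_s S1 x) (spl_i S2 w)) =
      B (F1 (spl_s S1 x)) (F2 (spl_i S2 w)) <-> b3 (l x w) = l (a1 x) (b2 w).
  rewrite F1s F2i linearDl /= B_i addr0 -!lE F3i.
  by split=> [/(spl_inj S3)|->].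
have on_is y v : F3 (B (spl_i S1 v) (spl_s S2 y)) =
      B (F1 (spl_i S1 v)) (F2 (spl_s S2 y)) <-> b3 (r y v) = r (a2 y) (b1 v).
  rewrite F1i F2s linearDr /= B_i addr0 -!rE F3i.
  by split=> [/(spl_inj S3)|->].
split=> [comm | [eq_ss eq_si eq_is] z w].
  by split=> *; [exact/on_ss | exact/on_si | exact/on_is].
rewrite (split_decomp S1 z) (split_decomp S2 w).
rewrite [F1 _]linearD [F2 _]linearD !linearDl !linearDr !linearD /=.
congr (_ + _ + (_ + _)); [|exact/on_is|exact/on_si|exact/on_ss].
by rewrite B_i F1i F2i B_i linear0.
Qed.

End SplitBilinear.

(** * The criteria for the two degrees of an extension *)

Section ExtensionSplitting.
Variables (K : fieldType) (V ph p : crossedModule K).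
Variables (E : extension V ph p) (Eab : abelian_extension E) (s : extSection E).

Definition split0 : splitExact (cm0 V) (cm0 ph) (cm0 p) :=
  @SplitExact K _ _ _ (hom0 (ext_i E)) (hom0 (ext_p E)) (sec0 s)
    (@ext_inj0 _ _ _ _ E) (@ext_exact0 _ _ _ _ E) (@sec0K _ _ _ _ _ s).

Definition split1 : splitExact (cm1 V) (cm1 ph) (cm1 p) :=
  @SplitExact K _ _ _ (hom1 (ext_i E)) (hom1 (ext_p E)) (sec1 s)
    (@ext_inj1 _ _ _ _ E) (@ext_exact1 _ _ _ _ E) (@sec1K _ _ _ _ _ s).

Variables (beta : cmAut V) (alpha : cmAut p).
Local Notation b0 := (hom0 beta).
Local Notation b1 := (hom1 beta).
Local Notation a0 := (hom0 alpha).
Local Notation a1 := (hom1 alpha).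
Variables (F0 : {linear cm0 ph -> cm0 ph}) (F1 : {linear cm1 ph -> cm1 ph}).
Variables (lam0 : cm0 p -> cm0 V) (lam1 : cm1 p -> cm1 V).
Hypotheses (F0a : adapted split0 F0 b0 a0 lam0) (F1a : adapted split1 F1 b1 a1 lam1).

Lemma adapted_fP :
  (forall a, F0 (cmf ph a) = cmf ph (F1 a)) <->
  (forall a, b0 (theta s a) - theta s (a1 a) = cmf V (lam1 a) - lam0 (cmf p a)).
Proof.
apply: (commute_linearP (S1 := split1) (S2 := split0) F1a F0a).
- by move=> v; rewrite /= hom_f.
- by move=> x; rewrite /= to_V0K.
- by move=> v; rewrite hom_f.
- by move=> x; rewrite hom_f.
Qed.

Lemma adapted_brP :
  (forall z w, F0 (br z w) = br (F0 z) (F0 w)) <->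
  [/\ forall x y, b0 (omega s x y) - omega s (a0 x) (a0 y) =
         l00 s (a0 x) (lam0 y) + r00 s (a0 y) (lam0 x) - lam0 (br x y),
      forall x w, b0 (l00 s x w) = l00 s (a0 x) (b0 w)
    & forall y v, b0 (r00 s y v) = r00 s (a0 y) (b0 v)].
Proof.
have [V00 _ _] := Eab.
apply: (preserve_bilinearP (B := leib_br (cm0 ph)) (BP := @br _ p)
  F0a F0a F0a) => //=.
- by move=> x y; rewrite to_V0K.
- by move=> x y; rewrite to_V0K.
- by move=> x y; rewrite to_V0K.
(* Abelianness is a statement inside [V]; the inclusion carries it to [ph]. *)
- by move=> v w; rewrite -[leib_br _ _ _]hom_br V00 linear0.
- by move=> x y; rewrite hom_br.
Qed.

Lemma adapted_brlP :
  (forall z w, F1 (brl z w) = brl (F0 z) (F1 w)) <->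
  [/\ forall x a, b1 (mu s x a) - mu s (a0 x) (a1 a) =
         l01 s (a0 x) (lam1 a) + r1 s (a1 a) (lam0 x) - lam1 (brl x a),
      forall x m, b1 (l01 s x m) = l01 s (a0 x) (b1 m)
    & forall a v, b1 (r1 s a v) = r1 s (a1 a) (b0 v)].
Proof.
have [_ V01 _] := Eab.
apply: (preserve_bilinearP (B := rep_lact (cm1 ph)) (BP := @brl _ p)
  F0a F1a F1a) => //=.
- by move=> x y; rewrite to_V1K.
- by move=> x y; rewrite to_V1K.
- by move=> x y; rewrite to_V1K.
- by move=> v w; rewrite -[rep_lact _ _ _]hom_brl V01 linear0.
- by move=> x y; rewrite hom_brl.
Qed.

(** Here the degree 1 argument comes first, so [l1] and [r01] occur in the opposite order to the
    theorem. *)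
Lemma adapted_brrP :
  (forall z w, F1 (brr z w) = brr (F1 z) (F0 w)) <->
  [/\ forall a x, b1 (nu s a x) - nu s (a1 a) (a0 x) =
         l1 s (a1 a) (lam0 x) + r01 s (a0 x) (lam1 a) - lam1 (brr a x),
      forall a v, b1 (l1 s a v) = l1 s (a1 a) (b0 v)
    & forall x m, b1 (r01 s x m) = r01 s (a0 x) (b1 m)].
Proof.
have [_ _ V10] := Eab.
apply: (preserve_bilinearP (B := rep_ract (cm1 ph)) (BP := @brr _ p)
  F1a F0a F1a) => //=.
- by move=> x y; rewrite to_V1K.
- by move=> x y; rewrite to_V1K.
- by move=> x y; rewrite to_V1K.
- by move=> v w; rewrite -[rep_ract _ _ _]hom_brr V10 linear0.
- by move=> x y; rewrite hom_brr.
Qed.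

End ExtensionSplitting.

Unset Implicit Arguments.

Theorem theorem5p8 (K : fieldType) (V ph p : crossedModule K)
    (E : extension V ph p) (Eab : abelian_extension E) (s : extSection E)
    (beta : cmAut V) (alpha : cmAut p) :
  let b0 := hom0 beta in
  let b1 := hom1 beta in
  let a0 := hom0 alpha in
  let a1 := hom1 alpha in
  inducible s beta alpha <->
  exists (lam0 : {linear cm0 p -> cm0 V}) (lam1 : {linear cm1 p -> cm1 V}),
    forall (x y : cm0 p) (a : cm1 p) (v : cm0 V) (m : cm1 V),
    (b0 (theta s a) - theta s (a1 a) = cmf V (lam1 a) - lam0 (cmf p a)) /\
    (b0 (omega s x y) - omega s (a0 x) (a0 y)
       = l00 s (a0 x) (lam0 y) + r00 s (a0 y) (lam0 x) - lam0 (br x y)) /\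
    (b1 (mu s x a) - mu s (a0 x) (a1 a)
       = l01 s (a0 x) (lam1 a) + r1 s (a1 a) (lam0 x) - lam1 (brl x a)) /\
    (b1 (nu s a x) - nu s (a1 a) (a0 x)
       = r01 s (a0 x) (lam1 a) + l1 s (a1 a) (lam0 x) - lam1 (brr a x)) /\
    (b0 (l00 s x (aut_inv0 beta v)) = l00 s (a0 x) v) /\
    (b0 (r00 s x (aut_inv0 beta v)) = r00 s (a0 x) v) /\
    (b1 (l01 s x (aut_inv1 beta m)) = l01 s (a0 x) m) /\
    (b1 (r01 s x (aut_inv1 beta m)) = r01 s (a0 x) m) /\
    (b1 (r1 s a (aut_inv0 beta v)) = r1 s (a1 a) v) /\
    (b1 (l1 s a (aut_inv0 beta v)) = l1 s (a1 a) v).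
Proof.
move=> b0 b1 a0 a1; set S0 := split0 s; set S1 := split1 s.
split=> [[F [Fb0 Fb1 Fa0 Fa1]] | [lam0 [lam1 eqs]]].
  (* Lambda is the corner block of F: the [V] component of F on the section. *)
  exists (retract S0 \o (hom0 F \o sec0 s)), (retract S1 \o (hom1 F \o sec1 s)).
  have F0a : adapted S0 (hom0 F) b0 a0 (retract S0 \o (hom0 F \o sec0 s)).
    by apply: adapted_retract => // v; rewrite -Fb0 /= restr0K.
  have F1a : adapted S1 (hom1 F) b1 a1 (retract S1 \o (hom1 F \o sec1 s)).
    by apply: adapted_retract => // v; rewrite -Fb1 /= restr1K.
  have eq_f := (adapted_fP F0a F1a).1 (hom_f F).
  have [eq_om eq_l00 eq_r00] := (adapted_brP Eab F0a).1 (hom_br F).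
  have [eq_mu eq_l01 eq_r1] := (adapted_brlP Eab F0a F1a).1 (hom_brl F).
  have [eq_nu eq_l1 eq_r01] := (adapted_brrP Eab F0a F1a).1 (hom_brr F).
  move=> x y a v m; rewrite [r01 _ _ _ + _]addrC.
  rewrite eq_f eq_om eq_mu eq_nu eq_l00 eq_r00 eq_l01 eq_r01 eq_r1 eq_l1.
  by rewrite aut_inv0K aut_inv1K.
have F0a := glue_adapted S0 b0 a0 lam0.
have F1a := glue_adapted S1 b1 a1 lam1.
(* Evaluating at images under beta cancels its inverses. Below, zeros fill the variables absent from
   the equation being extracted. *)
have {}eqs x y a v m := eqs x y a (b0 v) (b1 m).
have F_f : forall a, glue S0 b0 a0 lam0 (cmf ph a) = cmf ph (glue S1 b1 a1 lam1 a).
  by apply/(adapted_fP F0a F1a) => a; have [] := eqs 0 0 a 0 0.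
have F_br : forall z w, glue S0 b0 a0 lam0 (br z w)
    = br (glue S0 b0 a0 lam0 z) (glue S0 b0 a0 lam0 w).
  apply/(adapted_brP Eab F0a); split=> [x y|x v|x v].
  - by have [_ [->]] := eqs x y 0 0 0.
  - by have [_ [_ [_ [_ [<- _]]]]] := eqs x 0 0 v 0; rewrite aut_0K.
  - by have [_ [_ [_ [_ [_ [<- _]]]]]] := eqs x 0 0 v 0; rewrite aut_0K.
have F_brl : forall z w, glue S1 b1 a1 lam1 (brl z w)
    = brl (glue S0 b0 a0 lam0 z) (glue S1 b1 a1 lam1 w).
  apply/(adapted_brlP Eab F0a F1a); split=> [x a|x m|a v].
  - by have [_ [_ [-> _]]] := eqs x 0 a 0 0.
  - by have [_ [_ [_ [_ [_ [_ [<- _]]]]]]] := eqs x 0 0 0 m; rewrite aut_1K.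
  - by have [_ [_ [_ [_ [_ [_ [_ [_ [<- _]]]]]]]]] := eqs 0 0 a v 0; rewrite aut_0K.
have F_brr : forall z w, glue S1 b1 a1 lam1 (brr z w)
    = brr (glue S1 b1 a1 lam1 z) (glue S0 b0 a0 lam0 w).
  apply/(adapted_brrP Eab F0a F1a); split=> [a x|a v|x m].
  - by rewrite [l1 _ _ _ + _]addrC; have [_ [_ [_ [-> _]]]] := eqs x 0 a 0 0.
  - by have [_ [_ [_ [_ [_ [_ [_ [_ [_ <-]]]]]]]]] := eqs 0 0 a v 0; rewrite aut_0K.
  - by have [_ [_ [_ [_ [_ [_ [_ [<- _]]]]]]]] := eqs x 0 0 0 m; rewrite aut_1K.
pose F := CMHom F_f F_br F_brl F_brr.
have F_bij0 : bijective (hom0 F).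
  by apply: glue_bij; [exact: aut_bij0 | exact: aut_bij0].
have F_bij1 : bijective (hom1 F).
  by apply: glue_bij; [exact: aut_bij1 | exact: aut_bij1].
have F_stab0 := glue_stab S0 a0 lam0 (aut_bij0 beta).
have F_stab1 := glue_stab S1 a1 lam1 (aut_bij1 beta).
pose FV : autV E := @AutV _ _ _ _ E (CMAut F_bij0 F_bij1) F_stab0 F_stab1.
exists FV; split=> x.
- by apply: (@ext_inj0 _ _ _ _ E); rewrite restr0K; exact: F0a.1.
- by apply: (@ext_inj1 _ _ _ _ E); rewrite restr1K; exact: F1a.1.
- by rewrite /induced0 /= (p_glue S0) /= sec0K.
- by rewrite /induced1 /= (p_glue S1) /= sec1K.
Qed.
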